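(* Let $n\ge 2$, let $\lambda_1=\lambda_1(\mathbb{H}^n)=\frac{(n-1)^2}{4}$, and let $\Omega\subsetneq\mathbb{H}^n$ be a domain such that $H^{(n-1)/2}(\partial_\infty\Omega)=0$. Then for every $\lambda\in[0,\lambda_1]$ there is no bounded $\lambda$-harmonic function of $\Omega$; that is, every bounded $u\in C(\overline{\Omega})\cap C^2(\Omega)$ with $-\Delta u=\lambda u$ in $\Omega$ and $u=0$ on $\partial\Omega$ is identically zero.
   Context: $\mathbb{H}^n$ is hyperbolic $n$-space, $\Delta$ its Laplace–Beltrami operator, and $\lambda_1(\mathbb{H}^n)=(n-1)^2/4$ the bottom of its spectrum. A domain is an open connected set. For a domain $\Omega\neq\mathbb{H}^n$, a $\lambda$-harmonic function of $\Omega$ is a nontrivial $u\in C(\overline\Omega)\cap C^2(\Omega)$ with $-\Delta u=\lambda u$ in $\Omega$ and $u=0$ on $\partial\Omega$. The asymptotic boundary $\partial_\infty\mathbb{H}^n$ is the set of equivalence classes of unit-speed geodesic rays, two rays being equivalent iff $d(\gamma_1(t),\gamma_2(t))$ stays bounded; $\overline{\mathbb{H}^n}=\mathbb{H}^n\cup\partial_\infty\mathbb{H}^n$ carries the cone topology (generated by open subsets of $\mathbb{H}^n$ and truncated cones). For $\Omega\subset\mathbb{H}^n$, $\partial_\infty\Omega$ is the boundary of $\Omega$ in $\overline{\mathbb{H}^n}$ (cone topology) minus its boundary in $\mathbb{H}^n$. In the Poincaré ball model ($B=\{p\in\mathbb{R}^n:|p|<1\}$ with metric $\frac{4}{(1-|p|^2)^2}\delta_{ij}$),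 $\partial_\infty\mathbb{H}^n$ is identified with the unit sphere $\partial B\subset\mathbb{R}^n$; for $X\subset\partial_\infty\mathbb{H}^n$, $H^r(X)=0$ means that the $r$-dimensional (Euclidean) Hausdorff measure of the image of $X$ in $\partial B$ is zero (this does not depend on the chosen model/center). *)

(* Defs.v *)
From mathcomp Require Import all_boot.
From Stdlib Require Import Reals.
Set Implicit Arguments. Unset Strict Implicit. Unset Printing Implicit Defensive.
Local Open Scope R_scope.

(* Points of R^n; H^n is realised as the Poincare ball model. *)
Definition Point (n : nat) := 'I_n -> R.

Definition rsum (n : nat) (F : 'I_n -> R) : R := \big[Rplus/0%R]_(i < n) F i.

Definition norm2 (n : nat) (p : Point n) : R := rsum (fun i => (p i) ^ 2).
Definition dist (n : nat) (p q : Point n) : R := sqrt (rsum (fun i => (p i - q i) ^ 2)).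

(* The Poincare ball B = {|p| < 1} = H^n; its ideal boundary is the unit sphere. *)
Definition in_ball (n : nat) (p : Point n) : Prop := norm2 p < 1.
Definition on_sphere (n : nat) (p : Point n) : Prop := norm2 p = 1.

Definition open_set (n : nat) (U : Point n -> Prop) : Prop :=
  forall p, U p -> exists r, 0 < r /\ forall q, dist p q < r -> U q.

(* Euclidean closure in R^n (used for the closed ball = H^n ∪ ∂_∞H^n). *)
Definition eclosure (n : nat) (A : Point n -> Prop) (p : Point n) : Prop :=
  forall r, 0 < r -> exists q, A q /\ dist p q < r.

Definition connected (n : nat) (A : Point n -> Prop) : Prop :=
  ~ (exists U V : Point n -> Prop, open_set U /\ open_set V /\
       (exists p, A p /\ U p) /\ (exists q, A q /\ V q) /\
       (forall p, A p -> U p \/ V p) /\ (forall p, A p -> U p -> V p -> False)).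

Definition domain (n : nat) (Om : Point n -> Prop) : Prop :=
  (forall p, Om p -> in_ball p) /\ open_set Om /\ connected Om.

Definition hclosure (n : nat) (Om : Point n -> Prop) (p : Point n) : Prop :=
  in_ball p /\ eclosure Om p.
Definition hboundary (n : nat) (Om : Point n -> Prop) (p : Point n) : Prop :=
  hclosure Om p /\ ~ Om p.

(* Asymptotic boundary: boundary of Om in the compactified ball (whose cone
   topology is the Euclidean topology of the closed ball) minus its boundary in H^n. *)
Definition asym_boundary (n : nat) (Om : Point n -> Prop) (p : Point n) : Prop :=
  on_sphere p /\ eclosure Om p.

Definition hausdorff_null (n : nat) (r : R) (X : Point n -> Prop) : Prop :=
  forall delta eps, 0 < delta -> 0 < eps ->
  exists (C : nat -> Point n -> Prop) (d : nat -> R),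
    (forall p, X p -> exists k, C k p) /\
    (forall k, 0 < d k /\ d k < delta) /\
    (forall k p q, C k p -> C k q -> dist p q <= d k) /\
    (forall N, sum_f_R0 (fun k => Rpower (d k) r) N < eps).

Definition continuous_on (n : nat) (S : Point n -> Prop) (u : Point n -> R) : Prop :=
  forall p, S p -> forall eps, 0 < eps -> exists delta, 0 < delta /\
    forall q, S q -> dist p q < delta -> Rabs (u q - u p) < eps.

Definition shift (n : nat) (p : Point n) (i : 'I_n) (t : R) : Point n :=
  fun j => if j == i then p j + t else p j.

Definition partial_at (n : nat) (u : Point n -> R) (i : 'I_n) (p : Point n) (l : R) : Prop :=
  derivable_pt_lim (fun t => u (shift p i t)) 0 l.

Definition C2_derivs (n : nat) (Om : Point n -> Prop) (u : Point n -> R)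
    (du : 'I_n -> Point n -> R) (d2u : 'I_n -> 'I_n -> Point n -> R) : Prop :=
  continuous_on Om u /\
  (forall i p, Om p -> partial_at u i p (du i p)) /\
  (forall i j p, Om p -> partial_at (du i) j p (d2u i j p)) /\
  (forall i, continuous_on Om (du i)) /\
  (forall i j, continuous_on Om (d2u i j)).

(* Laplace-Beltrami operator of the Poincare ball metric 4/(1-|p|^2)^2 δ_ij:
   Δu = (1-|p|^2)^2/4 Σ ∂_i∂_i u + (n-2)(1-|p|^2)/2 Σ p_i ∂_i u. *)
Definition hyp_laplacian (n : nat) (du : 'I_n -> Point n -> R)
    (d2u : 'I_n -> 'I_n -> Point n -> R) (p : Point n) : R :=
  (1 - norm2 p) ^ 2 / 4 * rsum (fun i => d2u i i p)
  + (INR n - 2) * (1 - norm2 p) / 2 * rsum (fun i => p i * du i p).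

Definition lambda1 (n : nat) : R := (INR n - 1) ^ 2 / 4.

(* Main.v *)
From HB Require Import structures.
From Stdlib Require Import Reals Lra Classical ClassicalEpsilon FunctionalExtensionality.
From Coquelicot Require Import Coquelicot.
From mathcomp Require Import all_boot.
Require Import Defs.
Set Implicit Arguments. Unset Strict Implicit. Unset Printing Implicit Defensive.
Local Open Scope R_scope.

(** Put s = (n-1)/2, so that lambda_1 = s^2. If l is a linear function of the
    hyperboloid model with normal of Lorentz square a, then Lap l = n l and
    |grad l|^2 = l^2 + a, hence (Lap + s^2) l^(-m) = (m-s)^2 l^(-m) + a m (m+1) l^(-m-2).
    Therefore l^(-s) - b l^(-s-2) is a strict supersolution for lambda_1 as soon as
    4 b > a s (s+1). Cover the asymptotic boundary by finitely many sets of small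
    diameters d_k and let l_k vanish on a hyperplane cutting off a cap of Euclidean
    size about d_k around the k-th set. Off the caps the domain is relatively compact in
    hyperbolic space, so comparing u with the sum of the barriers, which are at least a
    fixed constant on the boundaries of the caps, gives u(p) <= C(p) sum_k d_k^s.
    This tends to 0 because the s-dimensional Hausdorff measure vanishes. *)

(** * Finite sums, convergence and compactness *)

HB.instance Definition _ := Monoid.isComLaw.Build R 0 Rplus
  (fun x y z => esym (Rplus_assoc x y z)) Rplus_comm Rplus_0_l.

Section FiniteSums.
Variable n : nat.
Implicit Types (i : 'I_n) (F G : 'I_n -> R).

Lemma rsum_ext F G : (forall i, F i = G i) -> rsum F = rsum G.
Proof. by move=> FG; apply: eq_bigr. Qed.

Lemma rsum_plus F G : rsum (fun i => F i + G i) = rsum F + rsum G.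
Proof. exact: big_split. Qed.

Lemma rsum_scal c F : rsum (fun i => c * F i) = c * rsum F.
Proof.
rewrite /rsum; apply: (big_rec2 (fun x y => x = c * y)); first by ring.
by move=> i x y _ ->; ring.
Qed.

Lemma rsum_const c : rsum (fun _ : 'I_n => c) = INR n * c.
Proof.
rewrite /rsum big_const card_ord; elim: n => [|m IH]; first by rewrite /=; ring.
by rewrite iterS IH S_INR; ring.
Qed.

Lemma rsum_le F G : (forall i, F i <= G i) -> rsum F <= rsum G.
Proof.
move=> FG; rewrite /rsum.
by apply: (big_rec2 Rle) => [|i x y _ xy]; [lra | move: (FG i); lra].
Qed.

Lemma rsum_ge0 F : (forall i, 0 <= F i) -> 0 <= rsum F.
Proof.
move=> F0; have -> : 0 = rsum (fun _ : 'I_n => 0) by rewrite rsum_const; ring.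
exact: rsum_le.
Qed.

Lemma rsum_single i c : rsum (fun j => if j == i then c else 0) = c.
Proof.
rewrite /rsum (bigD1 i) //= eqxx big1 ?Rplus_0_r // => j /negbTE ->; done.
Qed.

Lemma rsum_term_le F i : (forall j, 0 <= F j) -> F i <= rsum F.
Proof.
move=> F0; rewrite -{1}(rsum_single i (F i)); apply: rsum_le => j.
by case: eqP => [->|_]; [lra | exact: F0].
Qed.

Lemma is_lim_seq_rsum (f : nat -> 'I_n -> R) (l : 'I_n -> R) :
  (forall i, is_lim_seq (fun k => f k i) (l i)) ->
  is_lim_seq (fun k => rsum (f k)) (rsum l).
Proof.
move=> fl; rewrite /rsum; elim: (index_enum _) => [|i r IH].
  rewrite big_nil; apply: is_lim_seq_ext (is_lim_seq_const 0) => k.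
  by rewrite big_nil.
rewrite big_cons; apply: is_lim_seq_ext (is_lim_seq_plus' _ _ _ _ (fl i) IH) => k.
by rewrite big_cons.
Qed.

End FiniteSums.


Definition dot n (p q : Point n) : R := rsum (fun i => p i * q i).

Definition conv n (x : nat -> Point n) (p : Point n) : Prop :=
  forall i, is_lim_seq (fun k => x k i) (p i).

Lemma dist_sq n (p q : Point n) : dist p q ^ 2 = norm2 p + norm2 q - 2 * dot p q.
Proof.
rewrite /dist pow2_sqrt; last by apply: rsum_ge0 => i; apply: pow2_ge_0.
rewrite (_ : _ - _ = norm2 p + (norm2 q + (-2) * dot p q)); last by ring.
by rewrite /dot -rsum_scal -!rsum_plus; apply: rsum_ext => i; ring.
Qed.

Lemma dist_lt n (p q : Point n) r :
  0 < r -> rsum (fun i => (p i - q i) ^ 2) < r ^ 2 -> dist p q < r.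
Proof.
move=> r0 h; rewrite -(sqrt_pow2 r); last by lra.
by apply: sqrt_lt_1_alt; split=> //; apply: rsum_ge0 => i; apply: pow2_ge_0.
Qed.

(** With both radii halved, the termwise bound (a + b)^2 <= 2 a^2 + 2 b^2 suffices in place of
    Cauchy-Schwarz. *)
Lemma dist_lt_triangle n (p q x : Point n) r :
  dist p x < r / 2 -> dist x q < r / 2 -> dist p q < r.
Proof.
move=> px xq.
have d0 y z : 0 <= @dist n y z by apply: sqrt_pos.
have S y z : rsum (fun i => (y i - z i) ^ 2) = @dist n y z ^ 2.
  by rewrite /dist pow2_sqrt //; apply: rsum_ge0 => i; apply: pow2_ge_0.
apply: dist_lt; first by move: (d0 p x); lra.
have h : rsum (fun i => (p i - q i) ^ 2) <=
    rsum (fun i => 2 * (p i - x i) ^ 2 + 2 * (x i - q i) ^ 2).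
  by apply: rsum_le => i; move: (pow2_ge_0 (p i - x i - (x i - q i))) => /=; nra.
move: h; rewrite rsum_plus !rsum_scal !S.
move: (d0 p x) (d0 x q); nra.
Qed.

Lemma coord_sq_le n (p : Point n) i : p i ^ 2 <= norm2 p.
Proof.
exact: (rsum_term_le (F := fun j => p j ^ 2) i (fun j => pow2_ge_0 (p j))).
Qed.

Section Convergence.
Variable n : nat.
Implicit Types (x : nat -> Point n) (p q xi : Point n).

Lemma conv_dot x p xi : conv x p -> is_lim_seq (fun k => dot (x k) xi) (dot p xi).
Proof.
move=> xp; apply: (is_lim_seq_rsum (f := fun k i => x k i * xi i)) => i.
exact: is_lim_seq_mult' (xp i) (is_lim_seq_const _).
Qed.

Lemma conv_norm2 x p : conv x p -> is_lim_seq (fun k => norm2 (x k)) (norm2 p).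
Proof.
move=> xp; apply: (is_lim_seq_rsum (f := fun k i => x k i ^ 2)) => i /=.
apply: is_lim_seq_mult' (xp i) _.
exact: is_lim_seq_mult' (xp i) (is_lim_seq_const _).
Qed.

Lemma conv_dist x p : conv x p -> forall r, 0 < r ->
  exists N, forall k, Peano.le N k -> dist p (x k) < r.
Proof.
move=> xp r r0.
have h : is_lim_seq (fun k => rsum (fun i => (p i - x k i) ^ 2))
    (rsum (fun i : 'I_n => (p i - p i) ^ 2)).
  apply: (is_lim_seq_rsum (f := fun k i => (p i - x k i) ^ 2)) => i /=.
  have hi := is_lim_seq_minus' _ _ _ _ (is_lim_seq_const (p i)) (xp i).
  apply: is_lim_seq_mult' (hi) _.
  exact: is_lim_seq_mult' hi (is_lim_seq_const _).
have r20 : 0 < r ^ 2 by apply: pow_lt.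
have [N hN] := (proj2 (is_lim_seq_spec _ _) h) (mkposreal _ r20).
have z : rsum (fun i => (p i - p i) ^ 2) = 0.
  by rewrite (rsum_ext (G := fun=> 0)) ?rsum_const => [|i] /=; ring.
exists N => k /hN; rewrite z => /=.
rewrite Rminus_0_r => /Rabs_def2 [h1 _]; apply: dist_lt => //=.
Qed.

Lemma conv_eclosure (A : Point n -> Prop) x p :
  (forall k, eclosure A (x k)) -> conv x p -> eclosure A p.
Proof.
move=> Ax /conv_dist xp r r0.
have r20 : 0 < r / 2 by lra.
have [N /(_ N (le_n N)) pN] := xp _ r20.
have [q [Aq xq]] := Ax N _ r20.
by exists q; split=> //; apply: dist_lt_triangle pN xq.
Qed.

Lemma is_lim_seq_continuous_on (S : Point n -> Prop) (u : Point n -> R) x p :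
  continuous_on S u -> (forall k, S (x k)) -> S p -> conv x p ->
  is_lim_seq (fun k => u (x k)) (u p).
Proof.
move=> cu Sx Sp /conv_dist xp; apply/is_lim_seq_spec => eps.
have [d [d0 hd]] := cu p Sp eps (cond_pos eps).
have [N hN] := xp d d0; exists N => k Nk.
exact: hd (Sx k) (hN k Nk).
Qed.

End Convergence.

Definition extraction (phi : nat -> nat) := forall k, Peano.lt (phi k) (phi (S k)).

Lemma is_lim_seq_extraction (u : nat -> R) l phi :
  extraction phi -> is_lim_seq u l -> is_lim_seq (fun k => u (phi k)) l.
Proof. by move=> /eventually_subseq; apply: is_lim_seq_subseq. Qed.

Lemma is_lim_seq_inv_INR : is_lim_seq (fun k => / INR k.+1) 0.
Proof.
apply/(is_lim_seq_incr_1 (fun k => / INR k)).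
by apply: (is_lim_seq_inv _ p_infty) => //; apply: is_lim_seq_INR.
Qed.

Lemma bounded_seq_extraction (u : nat -> R) (a b : R) :
  (forall k, a <= u k <= b) ->
  exists phi (l : R), extraction phi /\ is_lim_seq (fun k => u (phi k)) l.
Proof.
move=> ub; have [l ul] := Bolzano_Weierstrass u _ (compact_P3 a b) ub.
have next N k : {m | Peano.lt N m /\ Rabs (u m - l) < / INR k.+1}.
  apply: constructive_indefinite_description.
  have k0 : 0 < / INR k.+1 by apply/Rinv_0_lt_compat/lt_0_INR/Nat.lt_0_succ.
  (* The adherent value yields an index at least [N.+1], that is, one strictly above [N]. *)
  have [|m [Nm um]] := ul (disc l (mkposreal _ k0)) N.+1.
    by exists (mkposreal _ k0).
  by exists m.
pose phi := fix phi k := if k is j.+1 then sval (next (phi j) k) else sval (next O O).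
exists phi, l; split=> [k|]; first by have [] := svalP (next (phi k) k.+1).
have phil k : Rabs (u (phi k) - l) < / INR k.+1.
  by case: k => [|k]; [have [] := svalP (next O O) | have [] := svalP (next (phi k) k.+1)].
apply/is_lim_seq_spec => eps.
have [N hN] := (proj2 (is_lim_seq_spec _ _) is_lim_seq_inv_INR) eps.
exists N => k /hN /=; rewrite Rminus_0_r => h.
apply: Rlt_trans (phil k) _; exact: Rle_lt_trans (Rle_abs _) h.
Qed.

Lemma bounded_conv_extraction n (x : nat -> Point n) (M : R) :
  (forall k i, Rabs (x k i) <= M) ->
  exists phi p, extraction phi /\ conv (fun k => x (phi k)) p.
Proof.
move=> xM.
(* Coordinates are treated one at a time: convergence is claimed along a list of indices, and each
   new index costs one further extraction. *)
suff [phi [p [ephi cp]]] : exists phi (p : Point n), extraction phi /\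
    forall i, i \in enum 'I_n -> is_lim_seq (fun k => x (phi k) i) (p i).
  by exists phi, p; split=> // i; apply: cp; rewrite mem_enum.
elim: (enum 'I_n) => [|i s [phi [p [ephi cp]]]].
  by exists id, (fun=> 0); split=> [k|//]; apply: le_n.
have [k|psi [l [epsi cl]]] := bounded_seq_extraction (u := fun k => x (phi k) i) (a := - M) (b := M).
  by apply/Rabs_le_between; apply: xM.
exists (fun k => phi (psi k)), (fun j => if j == i then l else p j); split=> [k|j].
  have mono a b : Peano.lt a b -> Peano.lt (phi a) (phi b).
    elim=> [|m _ IH]; [exact: ephi | exact: Nat.lt_trans IH (ephi m)].
  exact: mono (epsi k).
rewrite inE; case: eqP => [-> _ //|_ /= js].
exact: is_lim_seq_extraction epsi (cp j js).
Qed.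

Lemma seq_compact_max n (K : Point n -> Prop) (f : Point n -> R) :
  (forall x, (forall k, K (x k)) ->
     exists phi p, extraction phi /\ conv (fun k => x (phi k)) p /\ K p) ->
  (forall x p, (forall k, K (x k)) -> K p -> conv x p ->
     is_lim_seq (fun k => f (x k)) (f p)) ->
  (exists p, K p) ->
  exists p, K p /\ forall q, K q -> f q <= f p.
Proof.
move=> Kc fc [p0 Kp0].
(* Composing with atan makes the supremum finite a priori. *)
have [|//|s [sub slub]] :=
    completeness (fun y => exists p, K p /\ y = atan (f p)).
- by exists (PI / 2) => _ [p [_ ->]]; move: (atan_bound (f p)); lra.
- by exists (atan (f p0)), p0.
have near k : {p | K p /\ s - / INR k.+1 < atan (f p)}.
  apply: constructive_indefinite_description; apply: NNPP => no.
  have k0 : 0 < / INR k.+1 by apply/Rinv_0_lt_compat/lt_0_INR/Nat.lt_0_succ.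
  have : s <= s - / INR k.+1; last by lra.
  apply: slub => _ [p [Kp ->]].
  by apply: Rnot_lt_le => lt; apply: no; exists p.
have [|phi [p [ephi [cp Kp]]]] := Kc (fun k => sval (near k)).
  by move=> k; have [] := svalP (near k).
exists p; split=> // q Kq; apply: Rnot_lt_le => /atan_increasing.
have -> : atan (f p) = s; last first.
  by apply/Rle_not_lt/sub; exists q.
have fp := fc _ _ (fun k => proj1 (svalP (near (phi k)))) Kp cp.
have afp := is_lim_seq_continuous _ _ _
  (derivable_continuous_pt _ _ (derivable_pt_atan _)) fp.
apply: Rle_antisym; first by apply: sub; exists p.
have := is_lim_seq_minus' _ _ _ _ (is_lim_seq_const s) (is_lim_seq_extraction ephi is_lim_seq_inv_INR).
rewrite Rminus_0_r => lims.
apply: (is_lim_seq_le _ _ (Rbar.Finite s) _ _ lims afp) => k.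
by have [_ /Rlt_le] := svalP (near (phi k)).
Qed.

(** * The functions [ell] and their Laplacians *)

Section Shift.
Variable n : nat.
Implicit Types (p q : Point n) (i : 'I_n).

Lemma shift0 p i : shift p i 0 = p.
Proof. by apply: functional_extensionality => j; rewrite /shift; case: eqP => _ //; ring. Qed.

Lemma shift_shift p i s t : shift (shift p i s) i t = shift p i (s + t).
Proof.
by apply: functional_extensionality => j; rewrite /shift; case: eqP => _ //; ring.
Qed.

Lemma dot_shift p q i t : dot (shift p i t) q = dot p q + t * q i.
Proof.
rewrite -(rsum_single i (t * q i)) /dot -rsum_plus; apply: rsum_ext => j.
by rewrite /shift; case: eqP => [->|_]; ring.
Qed.

Lemma norm2_shift p i t : norm2 (shift p i t) = norm2 p + 2 * p i * t + t ^ 2.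
Proof.
have -> : norm2 p + 2 * p i * t + t ^ 2 = norm2 p + (2 * p i * t + t ^ 2) by ring.
rewrite -(rsum_single i (2 * p i * t + t ^ 2)) /norm2 -rsum_plus.
by apply: rsum_ext => j; rewrite /shift; case: eqP => [->|_]; ring.
Qed.

Lemma dist_shift p i t : dist p (shift p i t) = Rabs t.
Proof.
rewrite -sqrt_Rsqr_abs /dist; congr sqrt; rewrite -(rsum_single i (Rsqr t)).
by apply: rsum_ext => j; rewrite /shift /Rsqr; case: eqP => _; ring.
Qed.

Lemma partial_at_shift (u : Point n -> R) i p t l :
  partial_at u i (shift p i t) l -> derivable_pt_lim (fun s => u (shift p i s)) t l.
Proof.
move=> h eps eps0; have [d hd] := h eps eps0; exists d => k k0 kd.
by have := hd k k0 kd; rewrite !shift_shift Rplus_0_l Rplus_0_r.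
Qed.

End Shift.

(* In the hyperboloid model [ell] is linear with spacelike normal of Lorentz square
   2 + d^2: a multiple of sinh of the signed distance to a hyperplane cutting off a cap
   of size comparable to [d] around [xi]. *)
Definition ell n (xi : Point n) (d : R) (x : Point n) : R :=
  (1 + norm2 x - 2 * (1 + d ^ 2) * dot x xi) / (d * (1 - norm2 x)).

Definition dell n (xi : Point n) (d : R) (i : 'I_n) (x : Point n) : R :=
  (2 * x i - 2 * (1 + d ^ 2) * xi i) / (d * (1 - norm2 x))
  + 2 * x i * (1 + norm2 x - 2 * (1 + d ^ 2) * dot x xi) / (d * (1 - norm2 x) ^ 2).

(** Only the pure second derivative along the [i]-th axis, which is all that the trace in
    [hyp_laplacian] sees. *)
Definition d2ell n (xi : Point n) (d : R) (i : 'I_n) (x : Point n) : R :=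
  2 / (d * (1 - norm2 x))
  + 2 * (1 + norm2 x - 2 * (1 + d ^ 2) * dot x xi) / (d * (1 - norm2 x) ^ 2)
  + 4 * x i * (2 * x i - 2 * (1 + d ^ 2) * xi i) / (d * (1 - norm2 x) ^ 2)
  + 8 * x i ^ 2 * (1 + norm2 x - 2 * (1 + d ^ 2) * dot x xi) / (d * (1 - norm2 x) ^ 3).

Section Ell.
Variables (n : nat) (xi : Point n) (d : R).
Hypothesis d0 : 0 < d.
Implicit Types (p x : Point n) (i : 'I_n).

Lemma partial_ell i p : in_ball p -> partial_at (ell xi d) i p (dell xi d i p).
Proof.
rewrite /in_ball => pB; apply/is_derive_Reals.
apply: (is_derive_ext (fun t =>
   (1 + (norm2 p + 2 * p i * t + t ^ 2) - 2 * (1 + d ^ 2) * (dot p xi + t * xi i))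
     / (d * (1 - (norm2 p + 2 * p i * t + t ^ 2))))) => [t|].
  by rewrite /ell norm2_shift dot_shift.
have h : d * (1 + - (norm2 p + 2 * p i * 0 + 0 ^ 2)) <> 0 by nra.
auto_derive; first by move: h => /=; tauto.
by rewrite /dell; field; lra.
Qed.

Lemma partial_dell i p : in_ball p -> partial_at (dell xi d i) i p (d2ell xi d i p).
Proof.
rewrite /in_ball => pB; apply/is_derive_Reals.
apply: (is_derive_ext (fun t =>
   (2 * (p i + t) - 2 * (1 + d ^ 2) * xi i) / (d * (1 - (norm2 p + 2 * p i * t + t ^ 2)))
   + 2 * (p i + t) * (1 + (norm2 p + 2 * p i * t + t ^ 2) - 2 * (1 + d ^ 2) * (dot p xi + t * xi i))
     / (d * (1 - (norm2 p + 2 * p i * t + t ^ 2)) ^ 2))) => [t|].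
  by rewrite /dell norm2_shift dot_shift /shift eqxx.
have h : d * (1 + - (norm2 p + 2 * p i * 0 + 0 ^ 2)) <> 0 by nra.
have h2 : d * (1 + - (norm2 p + 2 * p i * 0 + 0 ^ 2)) ^ 2 <> 0.
  by apply: Rmult_integral_contrapositive_currified; [lra | apply: pow_nonzero; nra].
auto_derive; first by move: h h2 => /=; tauto.
by rewrite /d2ell; field; lra.
Qed.

Hypothesis xiS : on_sphere xi.

(** The left side is the squared hyperbolic gradient. On the hyperboloid it is the Lorentz square of
    the tangential part of the normal, hence that of the normal plus [ell]^2. *)
Lemma grad_ell p : in_ball p ->
  (1 - norm2 p) ^ 2 / 4 * rsum (fun i => dell xi d i p ^ 2)
  = ell xi d p ^ 2 + (2 + d ^ 2).
Proof.
rewrite /in_ball => pB.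
set N := 1 + norm2 p - 2 * (1 + d ^ 2) * dot p xi.
(* [a] and [b] are the coefficients of [p i] and [xi i] in [dell], so the sum involves only
   [norm2 p], [dot p xi] and [norm2 xi], which is 1. *)
pose a := 2 / (d * (1 - norm2 p)) + 2 * N / (d * (1 - norm2 p) ^ 2).
pose b := - 2 * (1 + d ^ 2) / (d * (1 - norm2 p)).
rewrite (rsum_ext (G := fun i => a ^ 2 * p i ^ 2 + (2 * a * b * (p i * xi i) + b ^ 2 * xi i ^ 2))); last first.
  by move=> i; rewrite /dell -/N /a /b; field; lra.
rewrite !rsum_plus !rsum_scal -/(dot p xi) -/(norm2 p) -/(norm2 xi) xiS /ell /a /b /N.
by field; lra.
Qed.

(** The Hessian of a linear function on the hyperboloid is that function times the metric; taking
    the trace gives the factor n. The proof checks this by expansion in the ball model. *)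
Lemma lap_ell p : in_ball p ->
  hyp_laplacian (dell xi d) (fun i _ => d2ell xi d i) p = INR n * ell xi d p.
Proof.
rewrite /in_ball /hyp_laplacian => pB.
set N := 1 + norm2 p - 2 * (1 + d ^ 2) * dot p xi.
pose c := 2 / (d * (1 - norm2 p)) + 2 * N / (d * (1 - norm2 p) ^ 2).
pose a := 8 / (d * (1 - norm2 p) ^ 2) + 8 * N / (d * (1 - norm2 p) ^ 3).
pose b := - 8 * (1 + d ^ 2) / (d * (1 - norm2 p) ^ 2).
rewrite (rsum_ext (F := fun i => d2ell xi d i p) (G := fun i => c + (a * p i ^ 2 + b * (p i * xi i)))); last first.
  by move=> i; rewrite /d2ell -/N /a /b /c; field; lra.
pose b' := - 2 * (1 + d ^ 2) / (d * (1 - norm2 p)).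
rewrite (rsum_ext (F := fun i => p i * dell xi d i p) (G := fun i => c * p i ^ 2 + b' * (p i * xi i))); last first.
  by move=> i; rewrite /dell -/N /b' /c; field; lra.
rewrite (rsum_plus (fun=> c)) (rsum_const n c) !rsum_plus !rsum_scal -/(dot p xi) -/(norm2 p) /ell /a /b /b' /c /N.
by field; lra.
Qed.

Variables f f1 f2 : R -> R.
Hypothesis ff1 : forall r, 0 < r -> is_derive f r (f1 r).
Hypothesis f1f2 : forall r, 0 < r -> is_derive f1 r (f2 r).

Let g i x := f1 (ell xi d x) * dell xi d i x.
Let h i x := f2 (ell xi d x) * dell xi d i x ^ 2 + f1 (ell xi d x) * d2ell xi d i x.

Lemma partial_comp_ell i p : in_ball p -> 0 < ell xi d p ->
  partial_at (fun x => f (ell xi d x)) i p (g i p).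
Proof.
move=> pB l0; apply/is_derive_Reals; rewrite /g Rmult_comm.
apply: is_derive_comp; last by apply/is_derive_Reals; apply: partial_ell.
by rewrite shift0; apply: ff1.
Qed.

Lemma partial2_comp_ell i p : in_ball p -> 0 < ell xi d p ->
  partial_at (g i) i p (h i p).
Proof.
move=> pB l0.
have d1 : derivable_pt_lim (fun t => f1 (ell xi d (shift p i t))) 0
    (dell xi d i p * f2 (ell xi d p)).
  apply/is_derive_Reals; apply: is_derive_comp; last first.
    by apply/is_derive_Reals; apply: partial_ell.
  by rewrite shift0; apply: f1f2.
have := derivable_pt_lim_mult _ _ _ _ _ d1 (partial_dell i pB).
rewrite !shift0 (_ : _ + _ = h i p) //.
by rewrite /h; ring.
Qed.

(** Chain rule Lap f(l) = f''(l) |grad l|^2 + f'(l) Lap l. *)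
Lemma lap_comp_ell p : in_ball p ->
  hyp_laplacian g (fun i _ => h i) p =
  f2 (ell xi d p) * (ell xi d p ^ 2 + (2 + d ^ 2)) + f1 (ell xi d p) * (INR n * ell xi d p).
Proof.
move=> pB; rewrite -lap_ell // -grad_ell // /hyp_laplacian /g /h.
rewrite rsum_plus !rsum_scal (rsum_ext (F := fun i => p i * _)
  (G := fun i => f1 (ell xi d p) * (p i * dell xi d i p))) ?rsum_scal; last by move=> i; ring.
by ring.
Qed.

End Ell.

(** * Supersolutions and comparison *)

(** If [l] were positive, [g] would be positive just to the right of 0, and the mean value theorem
    would push [h] above [h 0]. *)
Lemma second_derivative_test (h g : R -> R) (l r : R) :
  0 < r -> (forall t, Rabs t < r -> derivable_pt_lim h t (g t)) ->
  derivable_pt_lim g 0 l -> (forall t, Rabs t < r -> h t <= h 0) ->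
  g 0 = 0 /\ l <= 0.
Proof.
move=> r0 hg gl hmax.
have z : Rabs 0 < r by rewrite Rabs_R0.
have g0 : g 0 = 0.
  rewrite -(derive_pt_eq_0 _ _ _ (exist _ _ (hg 0 z)) (hg 0 z)).
  apply: (deriv_maximum _ (- r) r); try lra.
  by move=> x x1 x2; apply: hmax; apply: Rabs_def1.
split=> //; apply: Rnot_lt_le => l0.
have l20 : 0 < l / 2 by lra.
have [[dl dl0] /= hd] := gl _ l20.
pose t1 := Rmin dl r / 2.
have m0 : 0 < Rmin dl r by apply: Rmin_glb_lt.
have t10 : 0 < t1 by rewrite /t1; lra.
have t1d : t1 < dl by move: (Rmin_l dl r); rewrite /t1; lra.
have t1r : t1 < r by move: (Rmin_r dl r); rewrite /t1; lra.
have hg1 c : 0 <= c <= t1 -> derivable_pt_lim h c (g c).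
  by move=> hc; apply: hg; apply: Rabs_def1; lra.
have [c [e [c0 ct]]] := MVT_cor2 h g 0 t1 t10 hg1.
have gc : 0 < g c.
  have := hd c (Rgt_not_eq _ _ c0); rewrite Rplus_0_l g0 Rminus_0_r => hdc.
  have /Rabs_def2 [_ low] : Rabs (g c / c - l) < l / 2.
    by apply: hdc; apply: Rabs_def1; lra.
  have -> : g c = g c / c * c by field; lra.
  by apply: Rmult_lt_0_compat; lra.
have := hmax t1 (Rabs_def1 _ _ t1r ltac:(lra)).
by move: (Rmult_lt_0_compat _ _ gc t10); nra.
Qed.

(** The derivatives are those along the axes, because the comparison at a touching point is made
    axis by axis. *)
Definition strict_supersolution n (S : Point n -> Prop) (mu : R) (w : Point n -> R) :=
  exists dw d2w : 'I_n -> Point n -> R,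
    (forall i p, S p -> partial_at w i p (dw i p)) /\
    (forall i p, S p -> partial_at (dw i) i p (d2w i p)) /\
    (forall p, S p -> mu * w p < - hyp_laplacian dw (fun i _ => d2w i) p).

Lemma strict_supersolution_sub n (S T : Point n -> Prop) mu w :
  (forall p, S p -> T p) -> strict_supersolution T mu w -> strict_supersolution S mu w.
Proof.
move=> ST [dw [d2w [h1 [h2 h3]]]]; exists dw, d2w.
by split; [|split] => *; auto.
Qed.

Lemma strict_supersolution_plus n (S : Point n -> Prop) mu v w :
  strict_supersolution S mu v -> strict_supersolution S mu w ->
  strict_supersolution S mu (fun x => v x + w x).
Proof.
move=> [dv [d2v [v1 [v2 v3]]]] [dw [d2w [w1 [w2 w3]]]].
exists (fun i x => dv i x + dw i x), (fun i x => d2v i x + d2w i x).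
split; [|split] => [i p Sp|i p Sp|p Sp].
- exact: derivable_pt_lim_plus (v1 i p Sp) (w1 i p Sp).
- exact: derivable_pt_lim_plus (v2 i p Sp) (w2 i p Sp).
- move: (v3 p Sp) (w3 p Sp); rewrite /hyp_laplacian rsum_plus.
  rewrite (rsum_ext (F := fun i => p i * (dv i p + dw i p))
    (G := fun i => p i * dv i p + p i * dw i p)) ?rsum_plus; last by move=> i; ring.
  by lra.
Qed.

(* At a point where [u <= m w] is an equality, the gradients agree and the pure second
   derivatives are ordered. *)
Lemma no_touching n (Om S : Point n -> Prop) lam mu u du d2u w m p r :
  C2_derivs Om u du d2u -> strict_supersolution S mu w ->
  - hyp_laplacian du d2u p = lam * u p -> lam <= mu ->
  0 < m -> 0 <= w p -> in_ball p -> 0 < r ->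
  (forall q : Point n, dist p q < r -> Om q /\ S q /\ u q <= m * w q) ->
  u p = m * w p -> False.
Proof.
move=> [_ [u1 [u2 _]]] [dw [d2w [w1 [w2 w3]]]] eqn lammu m0 w0 pB r0 near touch.
have axis i t : Rabs t < r -> Om (shift p i t) /\ S (shift p i t) /\
    u (shift p i t) <= m * w (shift p i t).
  by move=> tr; apply: near; rewrite dist_shift.
have crit i : du i p - m * dw i p = 0 /\ d2u i i p - m * d2w i p <= 0.
  have [Op [Sp _]] := axis i 0 ltac:(by rewrite Rabs_R0); rewrite shift0 in Op Sp.
  have g0 : derivable_pt_lim
      (fun t => du i (shift p i t) - m * dw i (shift p i t)) 0 (d2u i i p - m * d2w i p).
    apply: derivable_pt_lim_minus (u2 i i p Op) _.
    exact: derivable_pt_lim_scal (w2 i p Sp).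
  have := second_derivative_test (h := fun t => u (shift p i t) - m * w (shift p i t))
    r0 _ g0 _; rewrite !shift0; apply=> t /(axis i) [Ot [St ut]]; last by lra.
  apply: derivable_pt_lim_minus; first exact: partial_at_shift (u1 _ _ Ot).
  by apply: derivable_pt_lim_scal; apply: partial_at_shift (w1 _ _ St).
have [Op [Sp _]] : Om p /\ S p /\ u p <= m * w p.
  apply: near; rewrite /dist (rsum_ext (G := fun=> 0)) => [|i] /=; last by ring.
  by rewrite rsum_const Rmult_0_r sqrt_0.
have := w3 p Sp; move: eqn; rewrite /hyp_laplacian touch.
have -> : rsum (fun i => p i * du i p) = m * rsum (fun i => p i * dw i p).
  by rewrite -rsum_scal; apply: rsum_ext => i; have [? _] := crit i; nra.
have : rsum (fun i => d2u i i p) <= m * rsum (fun i => d2w i p).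
  by rewrite -rsum_scal; apply: rsum_le => i; have [_] := crit i; lra.
set A := rsum _; set A' := rsum _; set B := rsum _.
have : 0 <= (1 - norm2 p) ^ 2 / 4 by move: (pow2_ge_0 (1 - norm2 p)); lra.
set c := _ / 4; set e := _ / 2 => c0 AA eqn sup.
have h1 : c * A <= c * (m * A') by apply: Rmult_le_compat_l.
have h2 : m * (mu * w p) < m * - (c * A' + e * B) by apply: Rmult_lt_compat_l.
have h3 : lam * (m * w p) <= mu * (m * w p).
  by apply: Rmult_le_compat_r => //; apply: Rmult_le_pos; lra.
lra.
Qed.

(** The choice b = s (s + 1): the condition 4 b > a s (s + 1) then reads a < 4, and a = 2 + d^2 < 3
    when d < 1. *)
Definition barrier (s r : R) : R := Rpower r (- s) - s * (s + 1) * Rpower r (- s - 2).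

Lemma Rpower_minus_INR r s k : 0 < r -> Rpower r (s - INR k) = Rpower r s / r ^ k.
Proof. by move=> r0; rewrite /Rminus Rpower_plus Rpower_Ropp Rpower_pow. Qed.

Lemma barrierE s r : 0 < r -> barrier s r = Rpower r (- s) * (1 - s * (s + 1) / r ^ 2).
Proof.
move=> r0; have := Rpower_minus_INR (- s) 2 r0; rewrite /barrier /= => ->; field; lra.
Qed.

Section Barrier.
Variables (n : nat) (s : R).
Hypotheses (s0 : 0 < s) (ns : INR n = 2 * s + 1).

Lemma strict_supersolution_barrier (xi : Point n) (d : R) :
  0 < d < 1 -> on_sphere xi ->
  strict_supersolution (fun p => in_ball p /\ 0 < ell xi d p) (s ^ 2)
    (fun p => barrier s (ell xi d p)).
Proof.
move=> [d0 d1] xiS.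
pose f1 r := - s * Rpower r (- s - 1) - s * (s + 1) * ((- s - 2) * Rpower r (- s - 2 - 1)).
pose f2 r := - s * ((- s - 1) * Rpower r (- s - 1 - 1))
  - s * (s + 1) * ((- s - 2) * ((- s - 2 - 1) * Rpower r (- s - 2 - 1 - 1))).
have ff1 r : 0 < r -> is_derive (barrier s) r (f1 r).
  move=> r0; apply/is_derive_Reals; apply: derivable_pt_lim_minus.
    exact: derivable_pt_lim_power.
  by apply: derivable_pt_lim_scal; apply: derivable_pt_lim_power.
have f1f2 r : 0 < r -> is_derive f1 r (f2 r).
  move=> r0; apply/is_derive_Reals; apply: derivable_pt_lim_minus.
    by apply: derivable_pt_lim_scal; apply: derivable_pt_lim_power.
  by do 2! apply: derivable_pt_lim_scal; apply: derivable_pt_lim_power.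
do 2! eexists; split; [|split] => [i p [pB l0]|i p [pB l0]|p [pB l0]].
- exact: (partial_comp_ell d0 ff1 i pB l0).
- exact: (partial2_comp_ell d0 f1f2 i pB l0).
rewrite (lap_comp_ell d0 xiS _ _ pB) ns.
move: l0; set r := ell xi d p => l0.
rewrite /f1 /f2 barrierE //.
(* With every exponent in the form - s - INR k, the only real power left is [X], and the claim
   becomes rational in [r]. *)
have -> : - s - 2 - 1 - 1 = - s - INR 4 by rewrite /=; ring.
have -> : - s - 2 - 1 = - s - INR 3 by rewrite /=; ring.
have -> : - s - 1 - 1 = - s - INR 2 by rewrite /=; ring.
have -> : - s - 1 = - s - INR 1 by rewrite /=; ring.
rewrite !Rpower_minus_INR //.
set X := Rpower r (- s); have X0 : 0 < X by apply: exp_pos.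
apply: Rminus_gt_0_lt.
(* Here 2 - d^2 is 4 - a with a = 2 + d^2: the 4 is (m - s)^2 at m = s + 2, and a comes from the
   leading power, for which (m - s)^2 vanishes. *)
rewrite (_ : _ - _ = X * (s * (s + 1)) / r ^ 2 *
    ((2 - d ^ 2) + (2 + d ^ 2) * (s + 2) * (s + 3) / r ^ 2)); last by rewrite /=; field; lra.
have r20 : 0 < r ^ 2 by apply: pow_lt.
have B0 : 0 < s * (s + 1) by nra.
apply: Rmult_gt_0_compat; first by apply: Rdiv_lt_0_compat => //; apply: Rmult_lt_0_compat.
apply: Rplus_lt_0_compat; first by nra.
apply: Rdiv_lt_0_compat => //; apply: Rmult_lt_0_compat; last by lra.
by apply: Rmult_lt_0_compat; nra.
Qed.

End Barrier.

(** * Caps at infinity *)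

Lemma dist_conv n (x : nat -> Point n) (p : Point n) :
  (forall k, dist p (x k) < / INR k.+1) -> conv x p.
Proof.
move=> xp i; apply/is_lim_seq_spec => eps.
have [N hN] := (proj2 (is_lim_seq_spec _ _) is_lim_seq_inv_INR) eps.
exists N => k /hN; rewrite Rminus_0_r => h.
apply: Rle_lt_trans h; apply: Rle_trans (Rle_abs _); apply: Rle_trans (Rlt_le _ _ (xp k)).
rewrite Rabs_minus_sym -sqrt_Rsqr_abs; apply: sqrt_le_1_alt.
have := rsum_term_le (F := fun j => (p j - x k j) ^ 2) i (fun j => pow2_ge_0 _).
by rewrite /Rsqr /= Rmult_1_r.
Qed.

Definition seq_continuous n (f : Point n -> R) :=
  forall x p, conv x p -> is_lim_seq (fun k => f (x k)) (f p).

Lemma seq_continuous_pos_near n (f : Point n -> R) p :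
  seq_continuous f -> 0 < f p ->
  exists r, 0 < r /\ forall q, dist p q < r -> 0 < f q.
Proof.
move=> fc fp; apply: NNPP => no.
have bad k : {q | dist p q < / INR k.+1 /\ f q <= 0}.
  apply: constructive_indefinite_description; apply: NNPP => h; apply: no.
  exists (/ INR k.+1); split; first by apply/Rinv_0_lt_compat/lt_0_INR/Nat.lt_0_succ.
  by move=> q pq; apply: Rnot_le_lt => fq; apply: h; exists q.
have := fc _ p (dist_conv (fun k => proj1 (svalP (bad k)))) => lim.
have := is_lim_seq_le _ _ _ _ (fun k => proj2 (svalP (bad k))) lim (is_lim_seq_const 0).
by move=> /= h; lra.
Qed.

Lemma common_radius n (P : nat -> Point n -> Prop) p N :
  (forall k, (k <= N)%N -> exists r, 0 < r /\ forall q, dist p q < r -> P k q) ->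
  exists r, 0 < r /\ forall q, dist p q < r -> forall k, (k <= N)%N -> P k q.
Proof.
elim: N => [|N IH] h.
  have [r [r0 hr]] := h O isT; exists r; split=> // q pq [|//] _; exact: hr.
have [r1 [r10 h1]] := IH (fun k kN => h k (leqW kN)).
have [r2 [r20 h2]] := h N.+1 (leqnn _).
exists (Rmin r1 r2); split; first exact: Rmin_glb_lt.
move=> q pq k; rewrite leq_eqVlt ltnS => /orP [/eqP ->|kN].
  by apply: h2; apply: Rlt_le_trans pq (Rmin_r _ _).
by apply: h1 => //; apply: Rlt_le_trans pq (Rmin_l _ _).
Qed.

Lemma extraction_ge phi k : extraction phi -> (k <= phi k)%N.
Proof.
move=> ephi; elim: k => [//|k IH]; apply: leq_ltn_trans IH _.
by apply/ltP; apply: ephi.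
Qed.

Lemma closed_ball_extraction n (x : nat -> Point n) :
  (forall k, norm2 (x k) <= 1) ->
  exists phi p, extraction phi /\ conv (fun k => x (phi k)) p.
Proof.
move=> x1; apply: (@bounded_conv_extraction _ _ 1) => k i.
have h := Rle_trans _ _ _ (coord_sq_le (x k) i) (x1 k).
by apply: Rabs_le; split; nra.
Qed.

(** Points of [X] outside the first N sets [g k < 0] accumulate at a point of [X]. Some [g k] is
    negative there, although it is nonnegative along the tail of the sequence. *)
Lemma finite_subcover n (X : Point n -> Prop) (g : nat -> Point n -> R) :
  (forall p, X p -> norm2 p <= 1) ->
  (forall x p, (forall k, X (x k)) -> conv x p -> X p) ->
  (forall k, seq_continuous (g k)) ->
  (forall p, X p -> exists k, g k p < 0) ->
  exists N, forall p, X p -> exists k, (k <= N)%N /\ g k p < 0.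
Proof.
move=> X1 Xc gc cover; apply: NNPP => no.
have bad N : {p | X p /\ forall k, (k <= N)%N -> 0 <= g k p}.
  apply: constructive_indefinite_description; apply: NNPP => h; apply: no.
  exists N => p Xp; apply: NNPP => h'; apply: h; exists p; split=> // k kN.
  by apply: Rnot_lt_le => lt; apply: h'; exists k.
have Xx N : X (sval (bad N)) := proj1 (svalP (bad N)).
have [phi [p [ephi cp]]] := closed_ball_extraction (fun N => X1 _ (Xx N)).
have [k gk] := cover p (Xc _ _ (fun N => Xx (phi N)) cp).
have := is_lim_seq_le_loc _ _ _ _ _ (is_lim_seq_const 0) (gc k _ _ cp).
move=> lim; suff : Rbar_le 0 (g k p) by move=> /=; lra.
apply: lim; exists k => N kN; have [_] := svalP (bad (phi N)); apply.
by apply: leq_trans (extraction_ge N ephi); apply/leP.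
Qed.

Lemma eclosure_ball_norm2 n (Om : Point n -> Prop) p :
  (forall q, Om q -> in_ball q) -> eclosure Om p -> norm2 p <= 1.
Proof.
move=> Ob cl.
have app k : {q | Om q /\ dist p q < / INR k.+1}.
  apply: constructive_indefinite_description; apply: cl.
  by apply/Rinv_0_lt_compat/lt_0_INR/Nat.lt_0_succ.
have := conv_norm2 (dist_conv (fun k => proj2 (svalP (app k)))) => lim.
apply: (is_lim_seq_le _ _ _ _ _ lim (is_lim_seq_const 1)) => k.
exact: Rlt_le (Ob _ (proj1 (svalP (app k)))).
Qed.

Lemma asym_boundary_closed n (Om : Point n -> Prop) x p :
  (forall k, asym_boundary Om (x k)) -> conv x p -> asym_boundary Om p.
Proof.
move=> xA cx; split; last exact: conv_eclosure (fun k => proj2 (xA k)) cx.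
have := is_lim_seq_unique _ _ (conv_norm2 cx).
rewrite (Lim_seq_ext _ (fun=> 1)) ?Lim_seq_const; first by case.
by move=> k; have [] := xA k.
Qed.

(** [ell - l] cleared of its positive denominator: a polynomial, so it makes sense and stays
    continuous on the ideal boundary, where the denominator of [ell] vanishes. *)
Definition cap_fun n (xi : Point n) (d l : R) (x : Point n) : R :=
  1 + norm2 x - 2 * (1 + d ^ 2) * dot x xi - l * d * (1 - norm2 x).

Section Caps.
Variables (n : nat) (xi : Point n) (d : R).
Hypotheses (d0 : 0 < d) (xiS : on_sphere xi).

Lemma cap_funE l p : in_ball p ->
  cap_fun xi d l p = (ell xi d p - l) * (d * (1 - norm2 p)).
Proof. by rewrite /in_ball /cap_fun /ell => pB; field; lra. Qed.

Lemma cap_fun_ge0 l p : in_ball p -> 0 <= cap_fun xi d l p <-> l <= ell xi d p.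
Proof.
move=> pB; rewrite cap_funE //; move: pB; rewrite /in_ball => pB.
have h : 0 < d * (1 - norm2 p) by apply: Rmult_lt_0_compat; lra.
by split=> h'; [apply: Rnot_lt_le => ?; nra | apply: Rmult_le_pos; lra].
Qed.

Lemma cap_fun_gt0 l p : in_ball p -> 0 < cap_fun xi d l p <-> l < ell xi d p.
Proof.
move=> pB; rewrite cap_funE //; move: pB; rewrite /in_ball => pB.
have h : 0 < d * (1 - norm2 p) by apply: Rmult_lt_0_compat; lra.
by split=> h'; [apply: Rnot_le_lt => ?; nra | apply: Rmult_lt_0_compat; lra].
Qed.

Lemma seq_continuous_cap_fun l : seq_continuous (cap_fun xi d l).
Proof.
move=> x p xp; have c2 := conv_norm2 xp; have cd := conv_dot (xi := xi) xp.
apply: is_lim_seq_minus'; first apply: is_lim_seq_minus'.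
- exact: is_lim_seq_plus' (is_lim_seq_const 1) c2.
- exact: is_lim_seq_mult' (is_lim_seq_const _) cd.
- apply: is_lim_seq_mult' (is_lim_seq_const _) _.
  exact: is_lim_seq_minus' (is_lim_seq_const 1) c2.
Qed.

Lemma is_lim_seq_ell x p : in_ball p -> conv x p ->
  is_lim_seq (fun k => ell xi d (x k)) (ell xi d p).
Proof.
rewrite /in_ball => pB xp; have c2 := conv_norm2 xp; have cd := conv_dot (xi := xi) xp.
apply: is_lim_seq_div'; last by apply: Rmult_integral_contrapositive_currified; lra.
- apply: is_lim_seq_minus'.
  + exact: is_lim_seq_plus' (is_lim_seq_const 1) c2.
  + exact: is_lim_seq_mult' (is_lim_seq_const _) cd.
- apply: is_lim_seq_mult' (is_lim_seq_const _) _.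
  exact: is_lim_seq_minus' (is_lim_seq_const 1) c2.
Qed.

(** On the sphere the term in [l] vanishes and 2 [dot p xi] >= 2 - d^2, so the value is at most 2 -
    (1 + d^2) (2 - d^2) = - d^2 (1 - d^2). *)
Lemma cap_fun_lt0 l p : d < 1 -> on_sphere p -> dist p xi <= d -> cap_fun xi d l p < 0.
Proof.
move=> d1 pS px; have := dist_sq p xi; rewrite /cap_fun pS xiS => e.
have : dist p xi ^ 2 <= d ^ 2 by apply: pow_incr; split=> //; apply: sqrt_pos.
rewrite {}e => h; have : 0 < d ^ 2 < 1 by nra.
nra.
Qed.

(** Seen from a fixed point, [ell] is at least a constant over [d]; its power - s is then at most a
    constant times d^s, the term of the Hausdorff sum. *)
Lemma ell_lower p : in_ball p -> d <= (1 - norm2 p) / 4 ->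
  (1 - norm2 p) ^ 2 / 8 / d <= ell xi d p.
Proof.
rewrite /in_ball => pB dq.
have r0 : 0 <= norm2 p by apply: rsum_ge0 => i; apply: pow2_ge_0.
(* Cauchy-Schwarz is replaced by [|p - a xi|^2 >= 0] for [a = 1] and [a = rho],
   where [rho] lies strictly between [|p|^2] and 1. *)
pose rho := (1 + norm2 p) / 2.
have sq a : 0 <= norm2 p + a ^ 2 - 2 * a * dot p xi.
  have -> : norm2 p + a ^ 2 - 2 * a * dot p xi = rsum (fun i => (p i - a * xi i) ^ 2).
    have -> : norm2 p + a ^ 2 - 2 * a * dot p xi
      = norm2 p + (a ^ 2 * norm2 xi + (- 2 * a) * dot p xi) by rewrite xiS; ring.
    by rewrite /dot /norm2 -!rsum_scal -!rsum_plus; apply: rsum_ext => i; ring.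
  by apply: rsum_ge0 => i; apply: pow2_ge_0.
have h1 := sq 1; have := sq rho; rewrite /rho.
move: dq pB r0 h1; rewrite /ell; set t := norm2 p; set y := dot p xi => dq pB r0 h1 h2.
(* This is |p - xi|^2 >= (1 - |p|)^2 = (1 - t)^2 / (1 + |p|)^2, with |p| < 1. *)
have h3 : (1 - t) ^ 2 / 4 <= 1 + t - 2 * y.
  apply: Rnot_lt_le => h; nra.
apply: (Rmult_le_reg_r (d * (1 - t))); first by apply: Rmult_lt_0_compat; lra.
have -> : (1 - t) ^ 2 / 8 / d * (d * (1 - t)) = (1 - t) ^ 3 / 8 by field; lra.
have -> : (1 + t - 2 * (1 + d ^ 2) * y) / (d * (1 - t)) * (d * (1 - t))
  = 1 + t - 2 * y - 2 * d ^ 2 * y by field; lra.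
have h4 : d ^ 2 <= (1 - t) ^ 2 / 16 by nra.
have h5 : 2 * d ^ 2 * y <= 2 * ((1 - t) ^ 2 / 16) * 1.
  case: (Rle_lt_dec y 0) => y0; first by nra.
  apply: Rmult_le_compat; nra.
have : (1 - t) ^ 3 <= (1 - t) ^ 2 by nra.
lra.
Qed.

End Caps.

(** * The bound off the caps *)

Section BarrierSum.
Variables (n : nat) (s : R).
Hypotheses (s0 : 0 < s) (ns : INR n = 2 * s + 1).
Variables (xi : nat -> Point n) (d : nat -> R).
Hypotheses (d01 : forall k, 0 < d k < 1) (xiS : forall k, on_sphere (xi k)).

(** At this value the factor 1 - s (s + 1) / r^2 of the barrier equals 1/2, and it increases with
    [r]. *)
Definition threshold : R := sqrt (2 * (s * (s + 1))).

Lemma threshold_sq : threshold ^ 2 = 2 * (s * (s + 1)).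
Proof. by rewrite /threshold pow2_sqrt //; nra. Qed.

Lemma threshold_gt0 : 0 < threshold.
Proof. by apply: sqrt_lt_R0; nra. Qed.

Lemma barrier_gt0 r : threshold <= r -> 0 < barrier s r.
Proof.
move=> tr; have t0 := threshold_gt0; rewrite barrierE; last by lra.
apply: Rmult_lt_0_compat; first exact: exp_pos.
have r2 : 2 * (s * (s + 1)) <= r ^ 2 by rewrite -threshold_sq; apply: pow_incr; lra.
have B0 : 0 < s * (s + 1) by nra.
suff : s * (s + 1) / r ^ 2 < 1 by lra.
by apply: (Rmult_lt_reg_r (r ^ 2)); [lra | rewrite /Rdiv Rmult_assoc Rinv_l; lra].
Qed.

Lemma barrier_le r : 0 < r -> barrier s r <= Rpower r (- s).
Proof.
move=> r0; have P0 : 0 < Rpower r (- s - 2) by apply: exp_pos.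
have B0 : 0 < s * (s + 1) by nra.
by rewrite /barrier; nra.
Qed.

Lemma continuity_barrier r : 0 < r -> continuity_pt (barrier s) r.
Proof.
move=> r0; have c y : continuity_pt (fun r => Rpower r y) r.
  apply: derivable_continuous_pt; eexists; exact: derivable_pt_lim_power.
by apply: continuity_pt_minus => //; apply: continuity_pt_scal.
Qed.

Definition barrier_sum N (p : Point n) : R :=
  sum_f_R0 (fun k => barrier s (ell (xi k) (d k) p)) N.

Definition outside_caps N (p : Point n) : Prop :=
  forall k, (k <= N)%N -> threshold <= ell (xi k) (d k) p.

Lemma strict_supersolution_barrier_sum N :
  strict_supersolution
    (fun p => in_ball p /\ forall k, (k <= N)%N -> 0 < ell (xi k) (d k) p) (s ^ 2)
    (barrier_sum N).
Proof.
elim: N => [|N IH].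
  apply: strict_supersolution_sub (strict_supersolution_barrier s0 ns (d01 O) (xiS O)).
  by move=> p [pB l0]; split=> //; apply: l0.
apply: strict_supersolution_plus.
  by apply: strict_supersolution_sub IH => p [pB l0]; split=> // k kN; apply/l0/leqW.
apply: strict_supersolution_sub (strict_supersolution_barrier s0 ns (d01 N.+1) (xiS N.+1)).
by move=> p [pB l0]; split=> //; apply: l0.
Qed.

Lemma is_lim_seq_barrier_sum N x p :
  in_ball p -> outside_caps N p -> conv x p ->
  is_lim_seq (fun k => barrier_sum N (x k)) (barrier_sum N p).
Proof.
move=> pB; have t0 := threshold_gt0.
elim: N => [|N IH] out xp /=; last apply: is_lim_seq_plus'.
- apply: is_lim_seq_continuous (is_lim_seq_ell (proj1 (d01 _)) pB xp).
  by apply: continuity_barrier; move: (out O isT); lra.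
- by apply: IH => // k kN; apply/out/leqW.
- apply: is_lim_seq_continuous (is_lim_seq_ell (proj1 (d01 _)) pB xp).
  by apply: continuity_barrier; move: (out N.+1 (leqnn _)); lra.
Qed.

Lemma barrier_sum_gt0 N p : outside_caps N p -> 0 < barrier_sum N p.
Proof.
elim: N => [|N IH] out; first exact/barrier_gt0/out.
have outN : outside_caps N p by move=> j jN; apply/out/leqW.
by apply: Rplus_lt_0_compat (IH outN) _; apply/barrier_gt0/out.
Qed.

(** All summands are positive off the caps. On the boundary of the [k]-th cap this bounds the whole
    sum below by [barrier s threshold]. *)
Lemma barrier_le_sum N p k : outside_caps N p -> (k <= N)%N ->
  barrier s (ell (xi k) (d k) p) <= barrier_sum N p.
Proof.
elim: N => [|N IH] out; first by rewrite leqn0 => /eqP ->; apply: Rle_refl.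
have outN : outside_caps N p by move=> j jN; apply/out/leqW.
have b1 := barrier_gt0 (out N.+1 (leqnn _)).
have b0 := barrier_sum_gt0 outN.
rewrite /barrier_sum /= -/(barrier_sum N p) leq_eqVlt ltnS => /orP [/eqP ->|kN]; first by lra.
by move: (IH outN kN); lra.
Qed.

Variables (Om : Point n -> Prop) (lam M : R) (u : Point n -> R).
Variables (du : 'I_n -> Point n -> R) (d2u : 'I_n -> 'I_n -> Point n -> R).
Hypotheses (Hdom : domain Om) (Hlam : lam <= s ^ 2) (M0 : 0 <= M).
Hypotheses (Hcont : continuous_on (hclosure Om) u) (HC2 : C2_derivs Om u du d2u).
Hypothesis Heq : forall p, Om p -> - hyp_laplacian du d2u p = lam * u p.
Hypothesis Hbd : forall p, hboundary Om p -> u p = 0.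
Hypothesis uM : forall p, hclosure Om p -> u p <= M.

(* Off the caps [Om] is relatively compact in the ball, so [u / barrier_sum] has a maximum
   there; by [no_touching] it cannot be interior. *)
Lemma barrier_sum_bound N :
  (forall p, asym_boundary Om p ->
     exists k, (k <= N)%N /\ cap_fun (xi k) (d k) threshold p < 0) ->
  forall p, hclosure Om p -> outside_caps N p ->
  barrier s threshold * u p <= M * barrier_sum N p.
Proof.
move=> cover p0 p0Om p0out; apply: Rnot_lt_le => lt0.
have [Ob [Oopen _]] := Hdom.
pose K p := hclosure Om p /\ outside_caps N p.
have Kc x : (forall k, K (x k)) ->
    exists phi p, extraction phi /\ conv (fun k => x (phi k)) p /\ K p.
  move=> xK.
  have x1 k : norm2 (x k) <= 1 by have [[pB _] _] := xK k; apply: Rlt_le.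
  have [phi [p [ephi cp]]] := closed_ball_extraction x1.
  have clp : eclosure Om p.
    by apply: conv_eclosure cp => k; have [[]] := xK (phi k).
  have cap0 k : (k <= N)%N -> 0 <= cap_fun (xi k) (d k) threshold p.
    move=> kN.
    have lim := @seq_continuous_cap_fun n (xi k) (d k) threshold _ _ cp.
    apply: (is_lim_seq_le _ _ _ _ _ (is_lim_seq_const 0) lim) => j.
    have [[pB _] out] := xK (phi j).
    by apply/cap_fun_ge0 => //; [have [] := d01 k | apply: out].
  (* A limit on the sphere would lie in the asymptotic boundary, where [cover] makes some [cap_fun]
     negative, against [cap0]. *)
  have pB : in_ball p.
    case: (Rle_lt_or_eq_dec _ _ (eclosure_ball_norm2 Ob clp)) => // pS.
    have [k [kN]] := cover p (conj pS clp).
    by move: (cap0 k kN); lra.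
  exists phi, p; split=> //; split=> //; split=> // k kN.
  by apply/cap_fun_ge0; [have [] := d01 k | | apply: cap0].
have [x p xK [pOm pout] xp||p [[pOm pout] pmax]] :=
    @seq_compact_max _ K (fun p => u p / barrier_sum N p) Kc.
- apply: is_lim_seq_div'; last exact/Rgt_not_eq/barrier_sum_gt0.
  + by apply: is_lim_seq_continuous_on Hcont _ pOm xp => k; have [] := xK k.
  + by apply: is_lim_seq_barrier_sum => //; have [] := pOm.
- by exists p0.
have W0 := barrier_sum_gt0 pout.
have c0 := barrier_gt0 (Rle_refl threshold).
set m := u p / barrier_sum N p in pmax.
have um : u p = m * barrier_sum N p by rewrite /m; field; lra.
have le_m q : K q -> u q <= m * barrier_sum N q.
  move=> Kq; have [_ qout] := Kq; have Wq := barrier_sum_gt0 qout.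
  have -> : u q = u q / barrier_sum N q * barrier_sum N q by field; lra.
  by apply: Rmult_le_compat_r; [lra | exact: pmax].
(* The assumed failure at [p0] passes to the maximal ratio [m]. *)
have Mm : M < barrier s threshold * m.
  have Wp0 := barrier_sum_gt0 p0out.
  apply: (Rmult_lt_reg_r _ _ _ Wp0); apply: Rlt_le_trans lt0 _.
  by rewrite Rmult_assoc; apply: Rmult_le_compat_l; [lra | exact: le_m].
have m0 : 0 < m by apply: Rnot_le_lt => h; nra.
(* At a boundary point [u] vanishes, whereas [m * barrier_sum N p] is positive. *)
have Op : Om p.
  by apply: NNPP => nO; move: um; rewrite Hbd //; nra.
(* On the boundary of a cap, [barrier_sum N p >= barrier s threshold], so [u p] would exceed [M]. *)
have strict k : (k <= N)%N -> threshold < ell (xi k) (d k) p.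
  move=> kN; case: (Rle_lt_or_eq_dec _ _ (pout k kN)) => // e.
  by have := barrier_le_sum pout kN; rewrite -e; move: (uM pOm); nra.
have [r1 [r10 near1]] := Oopen p Op.
have [k kN|r2 [r20 near2]] := @common_radius _
    (fun k q => 0 < cap_fun (xi k) (d k) threshold q) p N.
  apply: seq_continuous_pos_near; first exact: seq_continuous_cap_fun.
  by apply/cap_fun_gt0; [have [] := d01 k | exact: Ob | exact: strict].
apply: (no_touching HC2 (strict_supersolution_barrier_sum N) (Heq Op) Hlam m0 _ (Ob _ Op)
  (Rmin_glb_lt _ _ _ r10 r20) _ um); first by lra.
move=> q pq.
have Oq : Om q by apply: near1; apply: Rlt_le_trans pq (Rmin_l _ _).
have qout k : (k <= N)%N -> threshold < ell (xi k) (d k) q.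
  move=> kN; apply/cap_fun_gt0; [by have [] := d01 k | exact: Ob |].
  by apply: near2 => //; apply: Rlt_le_trans pq (Rmin_r _ _).
split=> //; split.
  split; first exact: Ob.
  by move=> k /qout; have := threshold_gt0; lra.
apply: le_m; split; last by move=> k /qout /Rlt_le.
split; first exact: Ob.
move=> r r0; exists q; split=> //.
rewrite /dist (rsum_ext (G := fun=> 0)) => [|i] /=; last by ring.
by rewrite rsum_const Rmult_0_r sqrt_0.
Qed.

End BarrierSum.

(** * ** Shrinking caps and conclusion *)

Lemma cap_centers n (X : Point n -> Prop) (C : nat -> Point n -> Prop) (d : nat -> R) :
  (0 < n)%N -> (forall p, X p -> on_sphere p) ->
  (forall k p q, C k p -> C k q -> dist p q <= d k) ->
  exists xi : nat -> Point n, (forall k, on_sphere (xi k)) /\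
    forall k p, X p -> C k p -> dist p (xi k) <= d k.
Proof.
move=> n0 XS Cd.
suff h k : {xi : Point n | on_sphere xi /\ forall p, X p -> C k p -> dist p xi <= d k}.
  by exists (fun k => sval (h k)); split=> k; have [] := svalP (h k).
apply: constructive_indefinite_description.
case: (classic (exists p, X p /\ C k p)) => [[xi [Xxi Cxi]]|none].
  by exists xi; split=> [|p _ Cp]; [exact: XS | exact: Cd Cp Cxi].
(* A covering set that misses [X] gets the first basis vector as an arbitrary centre on the
   sphere. *)
exists (fun j => if j == Ordinal n0 then 1 else 0); split; last first.
  by move=> p Xp Cp; case: none; exists p.
apply: etrans (rsum_single (Ordinal n0) 1); apply: rsum_ext => j.
by case: eqP => _; ring.
Qed.

Lemma bounded_solution_le0 n (Om : Point n -> Prop) lam u du d2u M :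
  (2 <= n)%N -> domain Om ->
  hausdorff_null ((INR n - 1) / 2) (asym_boundary Om) -> lam <= lambda1 n ->
  continuous_on (hclosure Om) u -> C2_derivs Om u du d2u ->
  (forall p, Om p -> - hyp_laplacian du d2u p = lam * u p) ->
  (forall p, hboundary Om p -> u p = 0) ->
  (forall p, hclosure Om p -> u p <= M) ->
  forall p, hclosure Om p -> u p <= 0.
Proof.
move=> n2 Hdom; set s := (INR n - 1) / 2 => Hnull Hlam Hcont HC2 Heq Hbd uM p0 p0Om.
have s0 : 0 < s by have := le_INR _ _ (leP n2); rewrite /s /=; lra.
have ns : INR n = 2 * s + 1 by rewrite /s; field.
have Hlam' : lam <= s ^ 2 by move: Hlam; rewrite /lambda1 /s; lra.
apply: Rnot_lt_le => up0.
have [pB _] := p0Om; rewrite /in_ball in pB.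
have t0 := threshold_gt0 s0; have c0 := barrier_gt0 s0 (Rle_refl (threshold s)).
have q0 : 0 < 1 - norm2 p0 by lra.
set q := 1 - norm2 p0 in q0.
pose kappa := q ^ 2 / 8.
have k0 : 0 < kappa by rewrite /kappa; nra.
have kt0 : 0 < kappa / threshold s by apply: Rdiv_lt_0_compat.
have P0 : 0 < Rpower kappa (- s) by apply: exp_pos.
have M0 : 0 < M by move: (uM _ p0Om); lra.
(* The three bounds serve in turn for d < 1, for the hypothesis of [ell_lower] at [p0], and for
   [kappa / d >= threshold s], which puts [p0] outside every cap. *)
pose delta := Rmin 1 (Rmin (q / 4) (kappa / threshold s)).
have delta0 : 0 < delta by do 2! (apply: Rmin_glb_lt; try lra).
(* Chosen so that [M * Rpower kappa (- s) * eps] is exactly the left side of [barrier_sum_bound] at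
   [p0]; a Hausdorff sum below [eps] then contradicts that bound. *)
pose eps := barrier s (threshold s) * u p0 / (M * Rpower kappa (- s)).
have eps0 : 0 < eps by apply: Rdiv_lt_0_compat; apply: Rmult_lt_0_compat.
have [C [d [XC [dlt [Cd sumd]]]]] := Hnull delta eps delta0 eps0.
have [|xi [xiS xiC]] := cap_centers (X := asym_boundary Om) (ltnW n2) _ Cd.
  by move=> p [].
have d01 k : 0 < d k < 1.
  by have [? ?] := dlt k; move: (Rmin_l 1 (Rmin (q / 4) (kappa / threshold s))); rewrite -/delta; lra.
have dq k : d k <= q / 4.
  have [_ h] := dlt k; apply: Rle_trans (Rlt_le _ _ h) _.
  exact: Rle_trans (Rmin_r _ _) (Rmin_l _ _).
have dk k : d k <= kappa / threshold s.
  have [_ h] := dlt k; apply: Rle_trans (Rlt_le _ _ h) _.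
  exact: Rle_trans (Rmin_r _ _) (Rmin_r _ _).
have lower k : kappa / d k <= ell (xi k) (d k) p0.
  by apply: ell_lower => //; have [] := d01 k.
have [|||p Xp|N cover] := @finite_subcover _ (asym_boundary Om)
    (fun k => cap_fun (xi k) (d k) (threshold s)).
- by move=> p [-> _]; apply: Rle_refl.
- by move=> x p; apply: asym_boundary_closed.
- by move=> k; apply: seq_continuous_cap_fun.
- have [k Ckp] := XC p Xp; have [? ?] := d01 k; have [pS _] := Xp.
  by exists k; apply: cap_fun_lt0 => //; apply: xiC.
have out : outside_caps s xi d N p0.
  move=> k _; apply: Rle_trans (lower k); have [d0 _] := d01 k.
  apply: (Rmult_le_reg_r (d k)) => //; rewrite /Rdiv Rmult_assoc Rinv_l ?Rmult_1_r; last by lra.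
  have := Rmult_le_compat_l _ _ _ (Rlt_le _ _ t0) (dk k).
  by rewrite (_ : _ * (kappa / _) = kappa) //; field; lra.
have := barrier_sum_bound s0 ns d01 xiS Hdom Hlam' (Rlt_le _ _ M0) Hcont HC2 Heq Hbd uM
  cover p0Om out.
apply: Rlt_not_le.
(* Termwise, the barrier is at most [ell]^(-s) <= (kappa / d_k)^(-s) = kappa^(-s) d_k^s. *)
have WS : barrier_sum s xi d N p0 <= Rpower kappa (- s) * sum_f_R0 (fun k => Rpower (d k) s) N.
  rewrite scal_sum; apply: sum_Rle => k _; have [d0 _] := d01 k.
  have kd0 : 0 < kappa / d k by apply: Rdiv_lt_0_compat.
  apply: Rle_trans (barrier_le s0 (Rlt_le_trans _ _ _ kd0 (lower k))) _.
  have -> : Rpower (d k) s * Rpower kappa (- s) = Rpower (kappa / d k) (- s).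
    rewrite /Rpower -exp_plus; congr exp.
    by rewrite /Rdiv ln_mult ?ln_Rinv //; [ring | apply: Rinv_0_lt_compat].
  rewrite !Rpower_Ropp; apply: Rinv_le_contravar; first exact: exp_pos.
  by apply: Rle_Rpower_l; [lra | split].
apply: Rle_lt_trans (Rmult_le_compat_l _ _ _ (Rlt_le _ _ M0) WS) _.
have := Rmult_lt_compat_l (M * Rpower kappa (- s)) _ _ (Rmult_lt_0_compat _ _ M0 P0) (sumd N).
rewrite Rmult_assoc (_ : _ * eps = barrier s (threshold s) * u p0) //.
by rewrite /eps; field; lra.
Qed.

Lemma hyp_laplacian_opp n du d2u (p : Point n) :
  hyp_laplacian (fun i x => - du i x) (fun i j x => - d2u i j x) p = - hyp_laplacian du d2u p.
Proof.
rewrite /hyp_laplacian (rsum_ext (G := fun i => (-1) * d2u i i p)); last by move=> i; ring.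
rewrite (rsum_ext (F := fun i => p i * - du i p) (G := fun i => (-1) * (p i * du i p))); last by move=> i; ring.
by rewrite !rsum_scal; ring.
Qed.

Lemma continuous_on_opp n (S : Point n -> Prop) u :
  continuous_on S u -> continuous_on S (fun p => - u p).
Proof.
move=> uc p Sp eps eps0; have [d [d0 hd]] := uc p Sp eps eps0.
exists d; split=> // q Sq pq; rewrite (_ : _ - _ = - (u q - u p)); last by ring.
by rewrite Rabs_Ropp; apply: hd.
Qed.

Theorem theorem1 (n : nat) (Hn : (2 <= n)%nat) (Om : Point n -> Prop)
  (Hdom : domain Om)
  (Hproper : exists p, in_ball p /\ ~ Om p)
  (Hnull : hausdorff_null ((INR n - 1) / 2) (asym_boundary Om))
  (lam : R) (Hlam0 : 0 <= lam) (Hlam1 : lam <= lambda1 n)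
  (u : Point n -> R)
  (Hcont : continuous_on (hclosure Om) u)
  (du : 'I_n -> Point n -> R) (d2u : 'I_n -> 'I_n -> Point n -> R)
  (HC2 : C2_derivs Om u du d2u)
  (Heq : forall p, Om p -> - hyp_laplacian du d2u p = lam * u p)
  (Hbd : forall p, hboundary Om p -> u p = 0)
  (Hbounded : exists M, forall p, hclosure Om p -> Rabs (u p) <= M) :
  forall p, hclosure Om p -> u p = 0.
Proof.
have [M uM] := Hbounded.
move=> p clp; apply: Rle_antisym.
  apply: (bounded_solution_le0 (M := M) Hn Hdom Hnull Hlam1 Hcont HC2 Heq Hbd) => // q /uM.
  by move=> h; apply: Rle_trans (Rle_abs _) h.
(* The lower bound is the upper bound for - u, which solves the same linear problem. *)
apply: Ropp_le_cancel; rewrite Ropp_0; move: p clp.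
apply: (bounded_solution_le0 (u := fun p => - u p) (M := M) Hn Hdom Hnull Hlam1
  (continuous_on_opp Hcont) (du := fun i x => - du i x) (d2u := fun i j x => - d2u i j x)).
- have [h0 [h1 [h2 [h3 h4]]]] := HC2.
  split; first exact: continuous_on_opp.
  split; first by move=> i p Op; apply: derivable_pt_lim_opp (h1 i p Op).
  split; first by move=> i j p Op; apply: derivable_pt_lim_opp (h2 i j p Op).
  by split=> *; apply: continuous_on_opp.
- by move=> p Op; rewrite hyp_laplacian_opp Heq //; ring.
- by move=> p /Hbd ->; rewrite Ropp_0.
- by move=> p /uM; rewrite -Rabs_Ropp; apply: Rle_trans; apply: Rle_abs.
Qed.
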